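(* Let $(\mathfrak{X},+,\mathcal{A})$ be a measurable Abelian group, $n,b\in\mathbb{N}$, $x_1,\dots,x_b\in\mathfrak{X}\setminus\{0\}$. For $j\in\{1,\dots,n\}$ let \[F_j=p_{j,0}I+\sum_{r=1}^bp_{j,r}(I_{-x_r}+I_{x_r}),\] where $p_{j,r}\in[0,1]$ ($r\in\{0,\dots,b\}$) with $p_{j,0}+2\sum_{r=1}^bp_{j,r}=1$. Put $\overline{p}_r=\frac1n\sum_{j=1}^np_{j,r}$ and assume $\overline{p}_r>0$ for all $r\in\{0,\dots,b\}$. Let \[G=\overline{F}=\frac1n\sum_{j=1}^nF_j=\overline{p}_0I+\sum_{r=1}^b\overline{p}_r(I_{-x_r}+I_{x_r}).\] With $\eta_{\ell,1}$ as defined in the context, we have for every $\ell\in\{1,\dots,n\}$ \begin{align*} \eta_{\ell,1}\leq\sum_{j=1}^n\min\Big\{&\frac{4}{n^2}\Big(\frac{(\overline{p}_0-p_{j,0})^2}{2\overline{p}_0^2}+2\sum_{r=1}^b\frac{(\overline{p}_r-p_{j,r})^2}{\overline{p}_r\overline{p}_0}+\sum_{r=1}^b\frac{(\overline{p}_r-p_{j,r})^2}{\overline{p}_r^2}\Big),\\ &\frac{1}{(\ell+1)^2}\Big(|\overline{p}_0-p_{j,0}|+2\sum_{r=1}^b|\overline{p}_r-p_{j,r}|\Big)^2\Big\}. \end{align*}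
   Context: A measurable Abelian group $(\mathfrak{X},+,\mathcal{A})$ is a commutative group $(\mathfrak{X},+)$ with identity $0$ together with a $\sigma$-algebra $\mathcal{A}$ on $\mathfrak{X}$ such that $(x,y)\mapsto x-y$ is measurable from $(\mathfrak{X}\times\mathfrak{X},\mathcal{A}\otimes\mathcal{A})$ to $(\mathfrak{X},\mathcal{A})$. $I_x$ is the Dirac measure at $x\in\mathfrak{X}$ and $I=I_0$. Products and powers of finite signed measures on $(\mathfrak{X},\mathcal{A})$ are convolutions, with zeroth power equal to $I$. $\|V\|=(V^++V^-)(\mathfrak{X})$ is the total variation norm, where $V=V^+-V^-$ is the Hahn–Jordan decomposition. For probability distributions $F_1,\dots,F_n,G$ on $(\mathfrak{X},\mathcal{A})$ define, for $j,k\in\{1,\dots,n\}$ and $m\in\mathbb{N}$, \[M_{j,k}=(F_j-G)G^{\lfloor(n-k)/k\rfloor},\quad\nu_{k,m}=\sum_{j=1}^n\|M_{j,k}\|^m,\quad\widetilde{\nu}_k=\Big\|\sum_{j=1}^nM_{j,k}\Big\|,\] and for $\ell\in\{0,\dots,n\}$ \[\eta_{\ell,1}=\max_{k\in\{\ell+1,\dots,n\}}\Big[\frac{1}{k^2}\Big(\frac{\widetilde{\nu}_k^2}{4c_1}+\nu_{k,2}\Big)\Big],\qquad c_1=\sup_{x\in(0,\infty)}\frac{\ln(2-(1-x)e^x)}{x^2}=0.694025\ldots.\] (When $G=\overline{F}$ one has $\widetilde{\nu}_k=0$.) A maximum over the empty set (case $\ell=n$) is read as $0$. *)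

(* Defs.v *)
From HB Require Import structures.
From mathcomp Require Import all_boot all_order all_algebra.
From mathcomp Require Import all_classical all_reals all_analysis.

Set Implicit Arguments.
Unset Strict Implicit.
Unset Printing Implicit Defensive.

Import Order.TTheory GRing.Theory Num.Theory.
Import numFieldNormedType.Exports.

Local Open Scope classical_set_scope.
Local Open Scope ring_scope.

(* The library has no common substructure of measurableType and zmodType, so a
   commutative group is turned into a measurable type through this copy of it. *)
Definition mspace (X : zmodType) (A : set (set X))
  (sA : sigma_algebra [set: X] A) : Type := X.

Section mspace.
Variables (X : zmodType) (A : set (set X)) (sA : sigma_algebra [set: X] A).

HB.instance Definition _ := GRing.Zmodule.copy (mspace sA) X.

HB.instance Definition _ := isPointed.Build (mspace sA) (0 : X).

Let A0 : A set0. Proof. by case: sA. Qed.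

Let AC B : A B -> A (~` B).
Proof. by case: sA => _ + _ => /[apply]; rewrite setTD. Qed.

Let AU (B : (set X)^nat) : (forall i, A (B i)) -> A (\bigcup_i B i).
Proof. by case: sA => _ _; exact. Qed.

HB.instance Definition _ := isMeasurable.Build default_measure_display
  (mspace sA) A0 AC AU.

End mspace.

Record measurableAbGroup := MeasurableAbGroup {
  carrier :> zmodType ;
  salgebra : set (set carrier) ;
  salgebraP : sigma_algebra [set: carrier] salgebra ;
  measurable_subr : measurable_fun setT
    (fun z : mspace salgebraP * mspace salgebraP => z.1 - z.2)
}.

Notation gspace X := (mspace (salgebraP X)).

Lemma measurable_addr (X : measurableAbGroup) :
  measurable_fun setT (fun z : gspace X * gspace X => z.1 + z.2).
Proof.
have mB : measurable_fun setT (fun z : gspace X * gspace X => z.1 - z.2).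
  exact: measurable_subr.
have m0 : measurable_fun setT
    (fun z : gspace X * gspace X => (0 : gspace X, z.2)).
  by apply: measurable_fun_pair => //; exact: measurable_cst.
have mN : measurable_fun setT (fun z : gspace X * gspace X => 0 - z.2).
  exact: measurableT_comp mB m0.
have mP : measurable_fun setT (fun z : gspace X * gspace X => (z.1, 0 - z.2)).
  exact: measurable_fun_pair.
rewrite [X in measurable_fun _ X](_ : _ =
    (fun z : gspace X * gspace X => z.1 - z.2) \o
    (fun z : gspace X * gspace X => (z.1, 0 - z.2))).
  exact: measurableT_comp mB mP.
by apply/funext => z /=; rewrite sub0r opprK.
Qed.

Section jordan.
Context d (T : measurableType d) (R : realType).
Implicit Type V : {charge set T -> \bar R}.

Lemma hahn_pair V : {PN : set T * set T | hahn_decomposition V PN.1 PN.2}.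
Proof.
by apply: cid; have [P [N PN]] := Hahn_decomposition V; exists (P, N).
Qed.

Definition cpos V : {finite_measure set T -> \bar R} :=
  jordan_pos (svalP (hahn_pair V)).

Definition cneg V : {finite_measure set T -> \bar R} :=
  jordan_neg (svalP (hahn_pair V)).

Definition tvnorm V : R :=
  fine (charge_variation (svalP (hahn_pair V)) [set: T]).

Definition chadd V W : {charge set T -> \bar R} := cadd V W.

Definition chsub V W : {charge set T -> \bar R} := cadd V (copp W).

Definition chsum n (V : 'I_n -> {charge set T -> \bar R}) :
  {charge set T -> \bar R} :=
  \big[chadd/(czero : {charge set T -> \bar R})]_(j < n) V j.

Definition chprob (P : probability T R) : {charge set T -> \bar R} :=
  charge_of_finite_measure P.

End jordan.

Section convolution_finite_measure.
Context (X : measurableAbGroup) (R : realType).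
Variables mu nu : {finite_measure set gspace X -> \bar R}.

Definition fmconv : set (gspace X) -> \bar R :=
  pushforward (mu \x nu)%E (fun z : gspace X * gspace X => z.1 + z.2).

Local Lemma mpre (A : set (gspace X)) : measurable A ->
  measurable ((fun z : gspace X * gspace X => z.1 + z.2) @^-1` A).
Proof.
by move=> mA; rewrite -[X in measurable X]setTI; exact: measurable_addr.
Qed.

Let fmconv0 : fmconv set0 = 0%E.
Proof. by rewrite /fmconv /pushforward preimage_set0 measure0. Qed.

Let fmconv_ge0 A : (0 <= fmconv A)%E.
Proof. exact: (measure_ge0 (mu \x nu)%E). Qed.

Let fmconv_sigma_additive : semi_sigma_additive fmconv.
Proof.
move=> B mB tB mUB; rewrite /fmconv /pushforward preimage_bigcup.
apply: (@measure_semi_sigma_additive _ _ _ (mu \x nu)%E).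
- by move=> i; exact: mpre.
- apply/trivIsetP => i j _ _ ij; rewrite -preimage_setI.
  by move/trivIsetP : tB => -> //; rewrite preimage_set0.
- by rewrite -preimage_bigcup; exact: mpre.
Qed.

HB.instance Definition _ := isMeasure.Build _ _ _ fmconv
  fmconv0 fmconv_ge0 fmconv_sigma_additive.

Let fmconv_fin : fin_num_fun fmconv.
Proof.
apply: lty_fin_num_fun => /=.
have -> : fmconv setT = ((mu \x nu) (setT `*` setT))%E by rewrite setXTT.
by rewrite product_measure1E//= lte_mul_pinfty// ?fin_num_measure// -ge0_fin_numE//
  fin_num_measure.
Qed.

HB.instance Definition _ := @Measure_isFinite.Build _ _ _ fmconv fmconv_fin.

End convolution_finite_measure.

Section convolution.
Context (X : measurableAbGroup) (R : realType).
Implicit Type V : {charge set gspace X -> \bar R}.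

(* V * W, extended bilinearly from finite measures: with V = V^+ - V^- and
   W = W^+ - W^- this is (V^+W^+ + V^-W^-) - (V^+W^- + V^-W^+). *)
Definition chconv V W : {charge set gspace X -> \bar R} :=
  chsub (chadd (fmconv (cpos V) (cpos W)) (fmconv (cneg V) (cneg W)))
        (chadd (fmconv (cpos V) (cneg W)) (fmconv (cneg V) (cpos W))).

Fixpoint chpow V m : {charge set gspace X -> \bar R} :=
  if m is m'.+1 then chconv V (chpow V m') else chprob (\d_(0 : gspace X)).

End convolution.

Section eta.
Context (X : measurableAbGroup) (R : realType).
Variables (n : nat) (F : 'I_n -> probability (gspace X) R)
  (G : probability (gspace X) R).

Definition M (j : 'I_n) (k : nat) : {charge set gspace X -> \bar R} :=
  chconv (chsub (chprob (F j)) (chprob G)) (chpow (chprob G) ((n - k) %/ k)).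

Definition nu (k m : nat) : R := \sum_(j < n) tvnorm (M j k) ^+ m.

Definition nutilde (k : nat) : R := tvnorm (chsum (fun j => M j k)).

Definition c1 : R :=
  sup [set ln (2 - (1 - x) * expR x) / x ^+ 2 | x in [set x : R | 0 < x]].

(* The bracketed terms are nonnegative, so starting the maximum at 0 only
   matters for the empty range l = n, where the maximum is read as 0. *)
Definition eta1 (l : nat) : R :=
  \big[Num.max/0]_(l.+1 <= k < n.+1)
    (1 / k%:R ^+ 2 * (nutilde k ^+ 2 / (4 * c1) + nu k 2)).

End eta.

Definition pmean (R : realType) (n b : nat) (p : 'I_n -> 'I_b.+1 -> R)
  (r : 'I_b.+1) : R := (\sum_(j < n) p j r) / n%:R.

(* Main.v *)
Require Import Defs.
From mathcomp Require Import all_boot all_order all_algebra.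
From mathcomp Require Import all_classical all_reals all_analysis.
From mathcomp Require Import measurable_realfun ring lra zify.

(** As [G] is the mean of the [F j], the charges [M F G j k] sum to zero over
    [j] and [nutilde] vanishes. It remains to bound |(F_j - G) G^m|^2 / k^2,
    where m = floor((n - k) / k), by both terms of the minimum, for every
    k > l.

    The second term bounds it because convolution with the probability G^m does
    not increase the norm and k >= l + 1 ([tvnorm_M_le]).

    For the first term, put d = p_j - pmean p and q = pmean p. By symmetry
    F_j - G is a second difference,
      F_j - G = - \sum_r d_r (I_(x_r) - I) (I_(-x_r) - I).
    Expanding G^m over words of letters 0, +r, -r, and adding the two letters of
    the second difference, (F_j - G) G^m becomes the image, under the sum of the
    letters, of the law of m + 2 independent letters of law q multiplied by a
    density, namely a U-statistic of order two divided by the number of pairs.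
    Its kernel is the matrix A of the quadratic form above ([second_diff])
    divided by q_s q_t. As the rows of A sum to zero, the kernel is degenerate,
    different pairs of positions are uncorrelated, and Cauchy-Schwarz gives
      |(F_j - G) G^m|^2
        <= 2 / ((m + 2) (m + 1)) \sum_(s, t) A_(s,t)^2 / (q_s q_t)
    ([degenerate_walk_le]). Twice the double sum is exactly the bracket in the
    first term ([second_diff_density_energy]), and n / k < m + 2 turns
    1 / ((m + 2) (m + 1)) into at most 4 k^2 / n^2 ([sqr_ratio_le]).

    All the charges involved have finite support. They are represented by lists
    of weighted points, on which convolution is the pairwise product
    ([chconv_represented]) and the norm is the value at a function with values
    1 and -1 ([tvnorm_represented]). *)

Import Order.TTheory GRing.Theory Num.Theory.
Local Open Scope classical_set_scope.
Local Open Scope ring_scope.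

Set Implicit Arguments.
Unset Strict Implicit.

(** * Finitely supported charges and their convolution *)

Definition wsum {R : realType} {T : Type} (s : seq (R * T)) (h : T -> R) : R :=
  \sum_(a <- s) a.1 * h a.2.

Section represented.
Context {d : measure_display} {T : measurableType d} {R : realType}.
Implicit Types (s : seq (R * T)) (V W : {charge set T -> \bar R}).

(** Points of a measurable group need not form measurable singletons, so a
    finitely supported charge is recorded by a list of weighted points, possibly
    with repetitions and with weights of either sign; two lists may represent
    the same charge. *)
Definition represents (V : set T -> \bar R) s :=
  forall A, measurable A -> V A = (wsum s (\1_A))%:E.

Definition add_atom (mu : {measure set T -> \bar R}) (k : {nonneg R}) (y : T) :
  {measure set T -> \bar R} := measure_add mu (mscale k (\d_y)).

Lemma add_atomE mu k y A :
  (add_atom mu k y A = mu A + (k%:num * \1_A y)%:E)%E.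
Proof.
have -> : (add_atom mu k y A = mu A + mscale k (\d_y) A)%E.
  exact: measure_addE.
by rewrite /mscale/= diracE indicE EFinM.
Qed.

Lemma integral_add_atom mu k y (h : T -> R) :
  measurable_fun setT h -> (forall x, 0 <= h x) ->
  (\int[add_atom mu k y]_x (h x)%:E =
   \int[mu]_x (h x)%:E + (k%:num * h y)%:E)%E.
Proof.
move=> mh h0.
have mEh : measurable_fun setT (EFin \o h) by exact/measurable_EFinP.
have Eh0 (x : T) : setT x -> (0 <= (h x)%:E)%E by rewrite lee_fin.
rewrite ge0_integral_measure_add//; congr (_ + _)%E.
by rewrite ge0_integral_mscale// integral_dirac// diracT mul1e.
Qed.

(** The second measure [nu] makes the induction on [s] possible: the partial
    sums of signed weights need not be measures, so an atom of positive weight is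
    moved to [nu] and one of negative weight to [mu], both of which remain
    measures. *)
Lemma integral_shift_wsum s (mu nu : {measure set T -> \bar R}) (h : T -> R) :
  (forall A, measurable A -> mu A = nu A + (wsum s (\1_A))%:E)%E ->
  measurable_fun setT h -> (forall x, 0 <= h x) ->
  (\int[mu]_x (h x)%:E = \int[nu]_x (h x)%:E + (wsum s h)%:E)%E.
Proof.
move=> + mh h0.
elim: s mu nu => [|[c y] s IH] mu nu munu.
  rewrite /wsum big_nil adde0; apply: eq_measure_integral => A mA _.
  by have := munu A mA; rewrite /wsum big_nil adde0.
have [c0|c0] := leP 0 c.
  rewrite (IH mu (add_atom nu (NngNum c0) y)).
    by rewrite integral_add_atom //= /wsum big_cons EFinD addeA.
  by move=> A mA; rewrite munu// add_atomE /wsum big_cons/= EFinD addeA.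
have c0' : 0 <= - c by rewrite oppr_ge0 ltW.
have := IH (add_atom mu (NngNum c0') y) nu.
rewrite integral_add_atom// => /(_ _)/wrap[A mA|/=].
  rewrite add_atomE /= munu// -addeA -EFinD /wsum big_cons/=.
  by congr (_ + _%:E)%E; ring.
move=> /(congr1 (fun z => z - (- c * h y)%:E)%E).
rewrite addeK// => ->.
rewrite -addeA; congr (_ + _)%E.
by rewrite -EFinB /wsum big_cons /=; congr (_%:E); ring.
Qed.

Lemma integral_represented (mu : {measure set T -> \bar R}) s (h : T -> R) :
  represents mu s -> measurable_fun setT h -> (forall x, 0 <= h x) ->
  (\int[mu]_x (h x)%:E = (wsum s h)%:E)%E.
Proof.
move=> mus mh h0; rewrite (@integral_shift_wsum s mu mzero)//.
  by rewrite integral_measure_zero add0e.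
by move=> A mA; rewrite mus// /mzero add0e.
Qed.

Definition reweight (g : T -> R) s := [seq (a.1 * g a.2, a.2) | a <- s].

Lemma wsum_reweight g s h : wsum (reweight g s) h = wsum s (fun x => g x * h x).
Proof. by rewrite /wsum big_map; apply: eq_bigr => a _ /=; rewrite mulrA. Qed.

Lemma wsumN s h : wsum s (fun x => - h x) = - wsum s h.
Proof. by rewrite /wsum -sumrN; apply: eq_bigr => a _; rewrite mulrN. Qed.

Definition hahn_pos V : T -> R := \1_((sval (hahn_pair V)).1).

Definition hahn_neg V : T -> R := \1_((sval (hahn_pair V)).2).

Lemma hahn_indic V x :
  (hahn_pos V x == 1) && (hahn_neg V x == 0) ||
  (hahn_pos V x == 0) && (hahn_neg V x == 1).
Proof.
rewrite /hahn_pos /hahn_neg; case: hahn_pair => -[P N] /= [_ _ PUN PIN].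
rewrite !indicE; have := in_setT x; rewrite -PUN in_setU.
have : x \notin P `&` N by rewrite PIN in_set0.
by rewrite in_setI; case: (x \in P); case: (x \in N) => //=; rewrite !eqxx ?orbT.
Qed.

Lemma hahn_posD V x : hahn_pos V x + hahn_neg V x = 1.
Proof.
by case/orP: (hahn_indic V x) => /andP[/eqP -> /eqP ->]; rewrite (addr0,add0r).
Qed.

Lemma norm_hahn_sign V x : `|hahn_pos V x - hahn_neg V x| = 1.
Proof.
case/orP: (hahn_indic V x) => /andP[/eqP -> /eqP ->].
  by rewrite subr0 normr1.
by rewrite sub0r normrN1.
Qed.

(** On a Hahn decomposition the Jordan parts are restrictions, so they are again
    finitely supported, on the same points. Some of the new weights may still be
    negative, when the list has several atoms, perhaps at the same point, that no
    measurable set separates. *)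
Lemma cpos_represented V s :
  represents V s -> represents (cpos V) (reweight (hahn_pos V) s).
Proof.
move=> Vs A mA; rewrite wsum_reweight /cpos /hahn_pos.
case: hahn_pair => -[P N] [[mP ?] ? ? ?] /=.
rewrite jordan_posE cjordan_posE /crestr0 mem_set// /crestr.
rewrite Vs; last exact: measurableI.
by congr EFin; apply: eq_bigr => a _; rewrite indicI /=; congr (_ * _); rewrite mulrC.
Qed.

Lemma cneg_represented V s :
  represents V s ->
  represents (cneg V) (reweight (fun x => - hahn_neg V x) s).
Proof.
move=> Vs A mA; rewrite wsum_reweight /cneg /hahn_neg.
case: hahn_pair => -[P N] [? [mN ?] ? ?] /=.
rewrite jordan_negE cjordan_negE /crestr0 mem_set// /crestr.
rewrite Vs; last exact: measurableI.
rewrite -EFinN -wsumN.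
by congr EFin; apply: eq_bigr => a _; rewrite indicI /=; ring.
Qed.

(** The total variation is the integral of the sign function of the Hahn
    decomposition, which takes the values 1 and -1 only: a bound on [wsum s h]
    for all [h] with absolute value at most 1 bounds the norm. *)
Lemma tvnorm_represented V s : represents V s ->
  tvnorm V = wsum s (fun x => hahn_pos V x - hahn_neg V x).
Proof.
move=> Vs; rewrite /tvnorm.
have -> : charge_variation (svalP (hahn_pair V)) setT =
    (cpos V setT + cneg V setT)%E by [].
rewrite (cpos_represented Vs)// (cneg_represented Vs)// !wsum_reweight -EFinD/=.
rewrite /wsum -big_split/=; apply: eq_bigr => a _; rewrite indicT.
by rewrite /cst /=; ring.
Qed.

Lemma chsub_represented V W s t : represents V s -> represents W t ->
  forall A, measurable A ->
  chsub V W A = (wsum s (\1_A) - wsum t (\1_A))%:E.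
Proof. by move=> Vs Wt A mA; rewrite /= /cadd /= /copp Vs// Wt// EFinB. Qed.

Lemma chsum_apply n (V : 'I_n -> {charge set T -> \bar R}) A :
  chsum V A = (\sum_(j < n) V j A)%E.
Proof.
rewrite /chsum; elim/big_ind2 : _ => // U u W w HU HW.
by rewrite /chadd /= /cadd HU HW.
Qed.

End represented.

Section convolution.
Context {X : measurableAbGroup} {R : realType}.
Implicit Types (s t : seq (R * gspace X)).

Definition cvlist s t : seq (R * gspace X) :=
  [seq (a.1 * b.1, a.2 + b.2) | a <- s, b <- t].

Lemma wsum_cvlist s t h :
  wsum (cvlist s t) h = wsum s (fun x => wsum t (fun y => h (x + y))).
Proof.
rewrite /wsum big_allpairs_dep; apply: eq_bigr => a _ /=.
by rewrite mulr_sumr; apply: eq_bigr => b _; rewrite mulrA.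
Qed.

Lemma fmconv_represented (mu nu : {finite_measure set gspace X -> \bar R}) s t :
  represents mu s -> represents nu t -> represents (fmconv mu nu) (cvlist s t).
Proof.
move=> mus nut A mA; rewrite wsum_cvlist /fmconv /pushforward /product_measure1.
set B := _ @^-1` A.
have mB : measurable B by rewrite -[B]setTI; exact: measurable_addr.
have nuB x : nu (xsection B x) = (wsum t (fun y => \1_A (x + y)))%:E.
  rewrite nut; last exact: measurable_xsection.
  congr EFin; apply: eq_bigr => b _; congr (_ * _).
  by rewrite !indicE xsectionE /B; congr (_%:R); apply/idP/idP; rewrite !inE.
have -> : (nu \o xsection B) =
    (fun x => (wsum t (fun y => \1_A (x + y)))%:E) by apply/funext => x /=.
apply: integral_represented => //.
  apply/measurable_EFinP.
  rewrite [X in measurable_fun _ X](_ : _ = nu \o xsection B).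
    exact: measurable_fun_xsection.
  by apply/funext => x /=; rewrite nuB.
by move=> x; rewrite -lee_fin -nuB.
Qed.

(** Expanding the four products of Jordan parts, the product of the weights at
    each pair of points is multiplied by
    (1_P + 1_N)(x) (1_P' + 1_N')(y) = 1. *)
Lemma chconv_represented (V W : {charge set gspace X -> \bar R}) s t :
  represents V s -> represents W t -> represents (chconv V W) (cvlist s t).
Proof.
move=> Vs Wt A mA.
have [Vp Vn] := (cpos_represented Vs, cneg_represented Vs).
have [Wp Wn] := (cpos_represented Wt, cneg_represented Wt).
have -> : (chconv V W A =
    (fmconv (cpos V) (cpos W) A + fmconv (cneg V) (cneg W) A) -
    (fmconv (cpos V) (cneg W) A + fmconv (cneg V) (cpos W) A))%E by [].
rewrite (fmconv_represented Vp Wp)// (fmconv_represented Vn Wn)//.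
rewrite (fmconv_represented Vp Wn)// (fmconv_represented Vn Wp)//.
rewrite -!EFinD; congr EFin.
have cvE f g : wsum (cvlist (reweight f s) (reweight g t)) (\1_A) =
    \sum_(a <- s) \sum_(b <- t)
      a.1 * b.1 * \1_A (a.2 + b.2) * (f a.2 * g b.2).
  rewrite wsum_cvlist wsum_reweight; apply: eq_bigr => a _.
  rewrite wsum_reweight /wsum !mulr_sumr; apply: eq_bigr => b _.
  by ring.
rewrite !cvE -!big_split/= -sumrN -big_split/=.
rewrite wsum_cvlist /wsum; apply: eq_bigr => a _.
rewrite -!big_split/= -sumrN -big_split/= mulr_sumr; apply: eq_bigr => b _.
have := hahn_posD V a.2; have := hahn_posD W b.2.
move=> /(canRL (addrK _)) -> /(canRL (addrK _)) ->.
by ring.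
Qed.

End convolution.

(** * Degenerate U-statistics of random words *)

Section words.
Context {R : realFieldType} {S : finType}.
Variable q : S -> R.
Implicit Types (N : nat) (f g : seq S -> R) (phi : S -> R) (a : S -> S -> R).

(** Expectation of [f] at a word of [N] independent letters of law [q]. *)
Fixpoint expect N f : R :=
  if N is N'.+1 then \sum_s q s * expect N' (fun w => f (s :: w)) else f [::].

Lemma expectS N f :
  expect N.+1 f = \sum_s q s * expect N (fun w => f (s :: w)).
Proof. by []. Qed.

Lemma eq_expect N f g : f =1 g -> expect N f = expect N g.
Proof.
elim: N f g => [|N IH] f g fg /=; first exact: fg.
by apply: eq_bigr => s _; congr (_ * _); apply: IH => w; exact: fg.
Qed.

Lemma expectD N f g : expect N (fun w => f w + g w) = expect N f + expect N g.
Proof.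
elim: N f g => [|N IH] f g //=.
by rewrite -big_split/=; apply: eq_bigr => s _; rewrite IH mulrDr.
Qed.

Lemma expectZ N c f : expect N (fun w => c * f w) = c * expect N f.
Proof.
elim: N f => [|N IH] f //=.
by rewrite mulr_sumr; apply: eq_bigr => s _; rewrite IH mulrCA.
Qed.

Lemma expect_sum N (I : finType) (F : I -> seq S -> R) :
  expect N (fun w => \sum_i F i w) = \sum_i expect N (F i).
Proof.
elim: N F => [|N IH] F //=.
rewrite exchange_big/=; apply: eq_bigr => s _.
by rewrite -mulr_sumr -IH.
Qed.

Hypothesis q1 : \sum_s q s = 1.

Lemma expect_cst N c : expect N (fun=> c) = c.
Proof. by elim: N => //= N ->; rewrite -mulr_suml q1 mul1r. Qed.

Hypothesis q0 : forall s, 0 <= q s.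

Lemma expect_ge0 N f : (forall w, 0 <= f w) -> 0 <= expect N f.
Proof.
by elim: N f => [|N IH] f f0 //=; apply: sumr_ge0 => s _; rewrite mulr_ge0 ?IH.
Qed.

Lemma le_expect N f g : (forall w, f w <= g w) -> expect N f <= expect N g.
Proof.
move=> fg; rewrite -subr_ge0 -[- _]mulN1r -expectZ -expectD.
by apply: expect_ge0 => w; rewrite mulN1r subr_ge0.
Qed.

Lemma norm_expect_le1 N f : (forall w, `|f w| <= 1) -> `|expect N f| <= 1.
Proof.
move=> f1; rewrite ler_norml; apply/andP; split.
  rewrite -(expect_cst N (-1)); apply: le_expect => w.
  by have /ler_normlP[] := f1 w; lra.
rewrite -[leRHS](expect_cst N); apply: le_expect => w.
by have /ler_normlP[] := f1 w.
Qed.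

Lemma expect_cauchy_schwarz N f g : (forall w, `|g w| <= 1) ->
  expect N (fun w => f w * g w) ^+ 2 <= expect N (fun w => f w ^+ 2).
Proof.
move=> g1; set t := expect N _.
(* As the second moment of [g] is at most 1, the multiple [t] of [g] plays the
   part of the projection of [f] on [g]. *)
have : 0 <= expect N (fun w => (f w - t * g w) ^+ 2).
  by apply: expect_ge0 => w; exact: sqr_ge0.
rewrite (@eq_expect _ _ (fun w => f w ^+ 2 +
    ((- 2 * t) * (f w * g w) + t ^+ 2 * g w ^+ 2))); last by move=> w; ring.
rewrite 2!expectD 2!expectZ -/t.
have : expect N (fun w => g w ^+ 2) <= 1.
  rewrite -[leRHS](expect_cst N); apply: le_expect => w.
  by rewrite -real_normK ?num_real// expr_le1.
by move=> g21; have := ler_wpM2l (sqr_ge0 t) g21; nra.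
Qed.

Definition linstat phi (w : seq S) : R := \sum_(t <- w) phi t.

(** U-statistic of order two with kernel [a]; the earlier letter of a pair is the
    first argument, which matters as [a] need not be symmetric. *)
Fixpoint ustat a (w : seq S) : R :=
  if w is s :: w' then linstat (a s) w' + ustat a w' else 0.

Lemma expect_linstat N phi : expect N (linstat phi) = N%:R * \sum_t q t * phi t.
Proof.
elim: N => [|N IH]; first by rewrite /= /linstat big_nil mul0r.
rewrite /=; under eq_bigr => s _.
  rewrite (@eq_expect _ _ (fun w => phi s + linstat phi w)); last first.
    by move=> w; rewrite /linstat big_cons.
  rewrite expectD expect_cst IH mulrDr; over.
by rewrite big_split/= -mulr_suml q1 mul1r -natr1 mulrDl mul1r addrC.
Qed.

(** Independent centred letters are orthogonal, so variances add. *)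
Lemma expect_linstat_sqr N phi : \sum_t q t * phi t = 0 ->
  expect N (fun w => linstat phi w ^+ 2) = N%:R * \sum_t q t * phi t ^+ 2.
Proof.
move=> phi0; elim: N => [|N IH].
  by rewrite /= /linstat big_nil expr0n mul0r.
rewrite /=; under eq_bigr => s _.
  rewrite (@eq_expect _ _ (fun w => phi s ^+ 2 +
      ((2 * phi s) * linstat phi w + linstat phi w ^+ 2))); last first.
    by move=> w; rewrite /linstat big_cons; ring.
  rewrite 2!expectD expectZ expect_cst expect_linstat phi0 IH !mulr0 add0r.
  rewrite mulrDr; over.
by rewrite big_split/= -mulr_suml q1 mul1r -natr1 mulrDl mul1r addrC.
Qed.

(** Prefixing a letter [s] adds [linstat (a s)] to the U-statistic. The cross
    term vanishes because the kernel is centred in its first argument, and the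
    square of the increment is known because it is centred in its second; the
    number of pairs grows by Pascal's rule. *)
Lemma expect_ustat_sqr N a :
  (forall s, \sum_t q t * a s t = 0) -> (forall t, \sum_s q s * a s t = 0) ->
  expect N (fun w => ustat a w ^+ 2) =
    'C(N, 2)%:R * \sum_s \sum_t q s * q t * a s t ^+ 2.
Proof.
move=> ar0 ac0; elim: N => [|N IH]; first by rewrite /= expr0n mul0r.
rewrite /=; under eq_bigr => s _.
  rewrite (@eq_expect _ _ (fun w => linstat (a s) w ^+ 2 +
      (2 * (ustat a w * linstat (a s) w) + ustat a w ^+ 2))); last by move=> w; ring.
  rewrite 2!expectD expectZ expect_linstat_sqr// IH !mulrDr; over.
rewrite 2!big_split/= -mulr_suml q1 mul1r.
(* The average of the increment over the new letter is zero, word by word. *)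
have -> : \sum_s q s * (2 * expect N (fun w => ustat a w * linstat (a s) w)) = 0.
  transitivity (2 * expect N (fun w => ustat a w *
      \sum_s q s * linstat (a s) w)).
    rewrite -(@eq_expect _ (fun w =>
        \sum_s ustat a w * (q s * linstat (a s) w))); last first.
      by move=> w; rewrite mulr_sumr.
    rewrite expect_sum mulr_sumr; apply: eq_bigr => s _.
    rewrite mulrCA; congr (_ * _); rewrite -expectZ.
    by apply: eq_expect => w; ring.
  rewrite (@eq_expect _ _ (fun=> 0)) ?expect_cst ?mulr0// => w.
  rewrite /linstat; under eq_bigr do rewrite mulr_sumr.
  by rewrite exchange_big/= big1 ?mulr0.
rewrite add0r binS bin1 natrD mulrDl addrC; congr (_ + _).
rewrite mulr_sumr; apply: eq_bigr => s _.
by rewrite mulrCA mulr_sumr; congr (_ * _); apply: eq_bigr => t _; rewrite mulrA.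
Qed.

Context {X : zmodType}.
Variable y : S -> X.
Implicit Types (h : X -> R) (x : X).

(** Expectation of [h] at the position of a random walk started at [x], that is,
    the [N]-th convolution power of the step law applied to [h]. *)
Definition walk N h x : R := expect N (fun w => h (x + \sum_(t <- w) y t)).

Lemma walk0 h x : walk 0 h x = h x.
Proof. by rewrite /walk /= big_nil addr0. Qed.

Lemma walkS N h x : walk N.+1 h x = \sum_s q s * walk N h (x + y s).
Proof.
apply: eq_bigr => s _; congr (_ * _); apply: eq_expect => w.
by rewrite big_cons addrA.
Qed.

Lemma norm_walk_le1 N h x : (forall z, `|h z| <= 1) -> `|walk N h x| <= 1.
Proof. by move=> h1; apply: norm_expect_le1 => w; exact: h1. Qed.

(** The final position does not depend on the order of the steps, so every
    position of the word contributes the same amount; likewise for pairs in the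
    next lemma. *)
Lemma expect_linstat_walk N phi h x :
  expect N.+1 (fun w => linstat phi w * h (x + \sum_(t <- w) y t)) =
  N.+1%:R * \sum_t q t * phi t * walk N h (x + y t).
Proof.
elim: N x => [|N IH] x.
  rewrite /= mul1r; apply: eq_bigr => t _.
  by rewrite walk0 /linstat !big_seq1 mulrA.
rewrite expectS.
under eq_bigr => s _.
  rewrite (@eq_expect _ _ (fun w => phi s * h (x + y s + \sum_(t <- w) y t) +
      linstat phi w * h (x + y s + \sum_(t <- w) y t))); last first.
    by move=> w; rewrite /linstat !big_cons addrA mulrDl.
  rewrite expectD expectZ IH mulrDr -/(walk _ _ _); over.
rewrite big_split/= -[in RHS]natr1 mulrDl mul1r addrC; congr (_ + _).
  rewrite mulr_sumr; under eq_bigr do rewrite mulrCA mulr_sumr.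
  rewrite -mulr_sumr -mulr_sumr exchange_big/=; congr (_ * _).
  apply: eq_bigr => t _; rewrite walkS mulr_sumr; apply: eq_bigr => s _.
  by rewrite addrAC; ring.
by apply: eq_bigr => s _; rewrite mulrA.
Qed.

Lemma expect_ustat_walk N a h x :
  expect N.+2 (fun w => ustat a w * h (x + \sum_(t <- w) y t)) =
  'C(N.+2, 2)%:R *
    \sum_s \sum_t q s * q t * a s t * walk N h (x + y s + y t).
Proof.
elim: N x => [|N IH] x.
  rewrite mul1r; apply: eq_bigr => s _; rewrite mulr_sumr; apply: eq_bigr => t _.
  by rewrite walk0 /= /linstat !big_cons !big_nil !addr0 addrA !mulrA.
rewrite expectS.
under eq_bigr => s _.
  rewrite (@eq_expect _ _ (fun w =>
      linstat (a s) w * h (x + y s + \sum_(t <- w) y t) +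
      ustat a w * h (x + y s + \sum_(t <- w) y t))); last first.
    by move=> w; rewrite /= !big_cons addrA mulrDl.
  rewrite expectD expect_linstat_walk IH mulrDr; over.
rewrite big_split/= [in RHS]binS bin1 natrD mulrDl addrC; congr (_ + _).
  under eq_bigr do rewrite mulrCA.
  rewrite -mulr_sumr; congr (_ * _).
  transitivity (\sum_r \sum_s \sum_t
      q s * q t * a s t * (q r * walk N h (x + y s + y t + y r))).
    apply: eq_bigr => r _; rewrite mulr_sumr; apply: eq_bigr => s _.
    rewrite mulr_sumr; apply: eq_bigr => t _.
    rewrite [x + y r + y s]addrAC [x + y s + y r + y t]addrAC; ring.
  rewrite exchange_big/=; apply: eq_bigr => s _.
  rewrite exchange_big/=; apply: eq_bigr => t _.
  by rewrite walkS mulr_sumr.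
rewrite mulr_sumr; apply: eq_bigr => s _.
rewrite mulrCA; congr (_ * _); rewrite mulr_sumr; apply: eq_bigr => t _.
by rewrite !mulrA.
Qed.

(** The double sum is, up to the number of pairs, the correlation of a
    U-statistic with a function of the endpoint. Cauchy-Schwarz bounds its
    square by the second moment of the U-statistic, which by degeneracy is
    linear in the number of pairs: dividing leaves one factor of that number. *)
Lemma degenerate_walk_le N a h x : (forall z, `|h z| <= 1) ->
  (forall s, \sum_t q t * a s t = 0) -> (forall t, \sum_s q s * a s t = 0) ->
  'C(N.+2, 2)%:R *
    (\sum_s \sum_t q s * q t * a s t * walk N h (x + y s + y t)) ^+ 2 <=
  \sum_s \sum_t q s * q t * a s t ^+ 2.
Proof.
move=> h1 ar0 ac0.
have C0 : 0 < 'C(N.+2, 2)%:R :> R by rewrite ltr0n bin_gt0.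
rewrite -(ler_pM2l C0) -expect_ustat_sqr//.
have := @expect_cauchy_schwarz N.+2 (ustat a) (fun w => h (x + \sum_(t <- w) y t)).
rewrite expect_ustat_walk exprMn [X in X * _ <= _]expr2 -mulrA; apply.
by move=> w; exact: h1.
Qed.

End words.

(** * Second differences of symmetric laws *)

(** The summands of a symmetric law, kept apart as formal letters: in the group
    the points [x r], [- x r] for different [r] may coincide. *)
Definition cell b := (unit + ('I_b + 'I_b))%type.

Definition cell_index {b} (s : cell b) : 'I_b.+1 :=
  match s with
  | inl _ => ord0
  | inr (inl r) | inr (inr r) => lift ord0 r
  end.

Definition cell_point {X : zmodType} {b} (x : 'I_b -> X) (s : cell b) : X :=
  match s with
  | inl _ => 0
  | inr (inl r) => x r
  | inr (inr r) => - x r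
  end.

Lemma sum_cell {V : nmodType} b (f : cell b -> V) :
  \sum_s f s = f (inl tt) + \sum_r (f (inr (inl r)) + f (inr (inr r))).
Proof.
rewrite !big_sumType/=; congr (_ + _); last by rewrite -big_split.
by rewrite (big_pred1 tt)//; case.
Qed.

Section second_difference.
Context {R : realFieldType} {b : nat}.
Variables d q : 'I_b.+1 -> R.
Hypothesis d0 : d ord0 + 2 * \sum_(r < b) d (lift ord0 r) = 0.
Hypothesis q_neq0 : forall r, q r != 0.

(** The symmetric matrix of the quadratic form
    - \sum_r d_r (Z_(+r) - Z_0) (Z_(-r) - Z_0),
    where d_0 = -2 \sum_r d_r gives the coefficient d_0 / 2 of Z_0^2. Under
    Z_(+r) Z_(-r) = Z_0^2, true for Dirac masses at x_r, -x_r and 0, it equals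
    Z_0 \sum_s d_s Z_s; but contrary to the latter form its rows sum to zero. *)
Definition second_diff (s t : cell b) : R :=
  match s, t with
  | inl _, inl _ => d ord0 / 2
  | inl _, inr u | inr u, inl _ => d (cell_index (inr u)) / 2
  | inr (inl r), inr (inr r') | inr (inr r), inr (inl r') =>
      if r == r' then - d (lift ord0 r) / 2 else 0
  | _, _ => 0
  end.

(** The kernel of the U-statistic: [second_diff] relative to the law of two
    independent letters. *)
Definition second_diff_density (s t : cell b) : R :=
  second_diff s t / (q (cell_index s) * q (cell_index t)).

Lemma second_diffC s t : second_diff s t = second_diff t s.
Proof.
by case: s t => [u|[r|r]] [v|[r'|r']] //=; rewrite eq_sym; case: eqP => // ->.
Qed.

Lemma second_diff_row0 s : \sum_t second_diff s t = 0.
Proof.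
rewrite sum_cell; case: s => [u|[r|r]] /=.
- have -> : \sum_(r < b) (d (lift ord0 r) / 2 + d (lift ord0 r) / 2) =
      \sum_(r < b) d (lift ord0 r) by apply: eq_bigr => r _; lra.
  by move: d0; lra.
- under eq_bigr do rewrite add0r.
  rewrite (bigD1 r)//= eqxx big1 => [|i /negPf]; last by rewrite eq_sym => ->.
  by lra.
- under eq_bigr do rewrite addr0.
  rewrite (bigD1 r)//= eqxx big1 => [|i /negPf]; last by rewrite eq_sym => ->.
  by lra.
Qed.

(** Only the nonzero entries contribute; the energy of the kernel and its action
    on functions are both sums of this form. *)
Lemma sum_over_second_diff (f : R -> cell b -> cell b -> R)
    (o := inl tt : cell b) (c := fun r => d (lift ord0 r) / 2)
    (u := fun r => inr (inl r) : cell b) (v := fun r => inr (inr r) : cell b) :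
  (forall s t, f 0 s t = 0) ->
  \sum_s \sum_t f (second_diff s t) s t =
  f (d ord0 / 2) o o +
  \sum_r ((f (c r) o (u r) + f (c r) o (v r)) +
          (f (c r) (u r) o + f (- c r) (u r) (v r)) +
          (f (c r) (v r) o + f (- c r) (v r) (u r))).
Proof.
move=> f0.
have sumu r : \sum_t f (second_diff (u r) t) (u r) t =
    f (c r) (u r) o + f (- c r) (u r) (v r).
  rewrite sum_cell (bigD1 r)//= eqxx f0 add0r mulNr big1 ?addr0// => i.
  by rewrite eq_sym => /negPf ->; rewrite !f0 addr0.
have sumv r : \sum_t f (second_diff (v r) t) (v r) t =
    f (c r) (v r) o + f (- c r) (v r) (u r).
  rewrite sum_cell (bigD1 r)//= eqxx f0 addr0 mulNr big1 ?addr0// => i.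
  by rewrite eq_sym => /negPf ->; rewrite !f0 addr0.
rewrite sum_cell sum_cell/= -addrA -big_split/=; congr (_ + _).
by apply: eq_bigr => r _; rewrite sumu sumv !addrA.
Qed.

Lemma second_diff_density_row0 s :
  \sum_t q (cell_index t) * second_diff_density s t = 0.
Proof.
transitivity ((\sum_t second_diff s t) / q (cell_index s)).
  rewrite mulr_suml; apply: eq_bigr => t _; rewrite /second_diff_density.
  by field; rewrite !q_neq0.
by rewrite second_diff_row0 mul0r.
Qed.

Lemma second_diff_density_col0 t :
  \sum_s q (cell_index s) * second_diff_density s t = 0.
Proof.
rewrite -[RHS](second_diff_density_row0 t); apply: eq_bigr => s _.
by rewrite /second_diff_density second_diffC [q _ * q (cell_index t)]mulrC.
Qed.

Lemma second_diff_density_energy :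
  \sum_s \sum_t q (cell_index s) * q (cell_index t) *
    second_diff_density s t ^+ 2 =
  2^-1 * (d ord0 ^+ 2 / (2 * q ord0 ^+ 2)
    + 2 * \sum_(r < b) d (lift ord0 r) ^+ 2 / (q (lift ord0 r) * q ord0)
    + \sum_(r < b) d (lift ord0 r) ^+ 2 / q (lift ord0 r) ^+ 2).
Proof.
transitivity (\sum_s \sum_t second_diff s t ^+ 2 /
    (q (cell_index s) * q (cell_index t))).
  apply: eq_bigr => s _; apply: eq_bigr => t _; rewrite /second_diff_density.
  by field; rewrite !q_neq0.
rewrite (@sum_over_second_diff
  (fun z s t => z ^+ 2 / (q (cell_index s) * q (cell_index t))))/=; last first.
  by move=> s t; rewrite expr0n/= mul0r.
rewrite !mulrDr -addrA !mulr_sumr -big_split/=.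
congr (_ + _); first by field; rewrite q_neq0.
by apply: eq_bigr => r _; field; rewrite !q_neq0.
Qed.

(** The only place where the letters +r and -r are known to cancel: their product
    lands at 0, like the square of the letter 0. *)
Lemma sum_second_diff {X : zmodType} (x : 'I_b -> X) (H : X -> R) :
  \sum_s \sum_t second_diff s t * H (cell_point x s + cell_point x t) =
  \sum_s d (cell_index s) * H (cell_point x s).
Proof.
rewrite (@sum_over_second_diff
  (fun z s t => z * H (cell_point x s + cell_point x t)))/=; last first.
  by move=> s t; rewrite mul0r.
rewrite sum_cell/= addr0.
have -> : d ord0 / 2 * H 0 = (d ord0 - d ord0 / 2) * H 0 by field.
have -> : d ord0 / 2 = - \sum_(r < b) d (lift ord0 r) by move: d0; lra.
rewrite opprK mulrDl -addrA mulr_suml -big_split/=; congr (_ + _).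
by apply: eq_bigr => r _; rewrite !add0r !addr0 subrr addNr; field.
Qed.

End second_difference.

(** The key estimate: a symmetric perturbation [d] of mass zero of a symmetric
    law [q] is a second difference, so its effect after [N] further steps of law
    [q] has order 1/N, and not only N^(-1/2). *)
Lemma second_diff_walk_le {R : realFieldType} {b : nat} {X : zmodType}
    (d q : 'I_b.+1 -> R) (x : 'I_b -> X) N (h : X -> R) :
  d ord0 + 2 * \sum_(r < b) d (lift ord0 r) = 0 ->
  q ord0 + 2 * \sum_(r < b) q (lift ord0 r) = 1 ->
  (forall r, 0 < q r) -> (forall z, `|h z| <= 1) ->
  (N.+2 * N.+1)%:R * (\sum_s d (cell_index s) *
    walk (fun s => q (cell_index s)) (cell_point x) N h (cell_point x s)) ^+ 2
  <= d ord0 ^+ 2 / (2 * q ord0 ^+ 2)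
    + 2 * \sum_(r < b) d (lift ord0 r) ^+ 2 / (q (lift ord0 r) * q ord0)
    + \sum_(r < b) d (lift ord0 r) ^+ 2 / q (lift ord0 r) ^+ 2.
Proof.
move=> d0 q1 q0 h1; have qn0 r : q r != 0 by rewrite gt_eqF.
have qc1 : \sum_s q (cell_index s) = 1 :> R.
  rewrite sum_cell -[RHS]q1 mulr_sumr; congr (_ + _).
  by apply: eq_bigr => r _ /=; ring.
have := @degenerate_walk_le _ _ (fun s => q (cell_index s)) qc1
  (fun s => ltW (q0 _)) _ (cell_point x) N (second_diff_density d q) h 0 h1
  (second_diff_density_row0 d0 qn0) (second_diff_density_col0 d0 qn0).
rewrite second_diff_density_energy// -sum_second_diff//.
set D := \sum_s _; set E := \sum_s _; have -> : D = E.
  apply: eq_bigr => s _; apply: eq_bigr => t _; rewrite add0r.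
  by congr (_ * _); rewrite /second_diff_density; field; rewrite !qn0.
have -> : (N.+2 * N.+1)%:R = 2 * 'C(N.+2, 2)%:R :> R.
  have := bin_ffact N.+2 2; rewrite !ffactnS ffactn0 muln1 /= => <-.
  by rewrite mulnC natrM.
by move=> HE; rewrite -mulrA -ler_pdivlMl.
Qed.

(** * Norms of the measures M_(j,k) *)

Section powers.
Context {X : measurableAbGroup} {R : realType} {S : finType}.
Variables (q : S -> R) (y : S -> gspace X).

Definition atoms (c : S -> R) : seq (R * gspace X) :=
  [seq (c s, y s) | s <- index_enum S].

Lemma wsum_atoms c h : wsum (atoms c) h = \sum_s c s * h (y s).
Proof. by rewrite /wsum big_map. Qed.

Fixpoint power_atoms m : seq (R * gspace X) :=
  if m is m'.+1 then cvlist (atoms q) (power_atoms m') else [:: (1, 0)].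

Lemma chpow_represented (V : {charge set gspace X -> \bar R}) m :
  represents V (atoms q) -> represents (chpow V m) (power_atoms m).
Proof.
move=> Vq; elim: m => [|m IH]; last exact: chconv_represented.
by move=> A mA; rewrite /wsum big_seq1 mul1r /= indicE; exact: diracE.
Qed.

Lemma wsum_power_atoms m h x :
  wsum (power_atoms m) (fun z => h (x + z)) = walk q y m h x.
Proof.
elim: m x => [|m IH] x; first by rewrite walk0 /wsum big_seq1 mul1r addr0.
rewrite wsum_cvlist wsum_atoms walkS; apply: eq_bigr => s _.
by rewrite -IH; congr (_ * _); apply: eq_bigr => a _; rewrite addrA.
Qed.

Lemma wsum_conv_power_atoms c m h :
  wsum (cvlist (atoms c) (power_atoms m)) h =
  \sum_s c s * walk q y m h (y s).
Proof.
rewrite wsum_cvlist wsum_atoms; apply: eq_bigr => s _.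
by rewrite wsum_power_atoms.
Qed.

End powers.

Lemma tvnorm_eq0 (d : measure_display) (T : measurableType d) (R : realType)
    (V : {charge set T -> \bar R}) :
  (forall A, measurable A -> V A = 0%E) -> tvnorm V = 0.
Proof.
move=> V0; rewrite (@tvnorm_represented _ _ _ V [::]) /wsum ?big_nil// => A mA.
by rewrite V0// /wsum big_nil.
Qed.

(** With m = floor((n - k) / k) one has n / k < m + 2, and
    (m + 2)^2 <= 4 (m + 2) (m + 1). *)
Lemma sqr_ratio_le (R : realFieldType) (n k : nat) (t Q : R) :
  (0 < n)%N -> (0 < k)%N ->
  (((n - k) %/ k).+2 * ((n - k) %/ k).+1)%:R * t ^+ 2 <= Q ->
  t ^+ 2 / k%:R ^+ 2 <= 4 / n%:R ^+ 2 * Q.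
Proof.
move=> n0 k0; set m := (_ %/ _)%N => tQ.
have nk : (n <= m.+2 * k)%N.
  have : (n - k < m.+1 * k)%N by exact: ltn_ceil.
  by rewrite [(m.+2 * _)%N]mulSn -leq_subLR; move/ltnW.
have Q0 : 0 <= Q by apply: le_trans tQ; rewrite mulr_ge0 ?ler0n ?sqr_ge0.
have nk4 : (n ^ 2 <= 4 * (m.+2 * m.+1) * k ^ 2)%N.
  apply: (@leq_trans ((m.+2 * k) ^ 2)); first by rewrite leq_exp2r.
  rewrite expnMn leq_mul2r; apply/orP; right.
  by rewrite expnS expn1 mulnCA leq_mul2l; apply/orP; right; lia.
rewrite ler_pdivrMr ?exprn_gt0 ?ltr0n//.
rewrite [4 / _]mulrC -!mulrA ler_pdivlMl ?exprn_gt0 ?ltr0n//.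
have : (n ^ 2)%:R <= (4 * (m.+2 * m.+1) * k ^ 2)%:R :> R by rewrite ler_nat.
rewrite natrX natrM natrX (natrM _ 4) => /(ler_wpM2r (sqr_ge0 t)) /le_trans; apply.
by have := ler_wpM2r (sqr_ge0 (k%:R : R)) tQ; lra.
Qed.

Definition deviation {R : realType} {n b : nat} (p : 'I_n -> 'I_b.+1 -> R)
    (j : 'I_n) (r : 'I_b.+1) : R :=
  p j r - pmean p r.

Section perturbed_mean.
Context {R : realType} {X : measurableAbGroup} {n b : nat}.
Variables (x : 'I_b -> gspace X) (p : 'I_n -> 'I_b.+1 -> R).
Variables (F : 'I_n -> probability (gspace X) R) (G : probability (gspace X) R).
Hypothesis n0 : (0 < n)%N.
Hypothesis p1 : forall j, p j ord0 + 2 * \sum_(r < b) p j (lift ord0 r) = 1.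
Hypothesis pmean_gt0 : forall r, 0 < pmean p r.
Hypothesis FE : forall j (A : set (gspace X)), measurable A ->
    F j A = ((p j ord0)%:E * \d_(0%R : gspace X) A +
      \sum_(r < b) (p j (lift ord0 r))%:E * (\d_(- x r)%R A + \d_(x r) A))%E.
Hypothesis GE : forall A : set (gspace X), measurable A ->
    G A = ((n%:R^-1)%:E * \sum_(j < n) F j A)%E.

Local Notation cells c := (atoms (cell_point x) (fun s => c (cell_index s))).

Lemma F_represented j : represents (chprob (F j)) (cells (p j)).
Proof.
move=> A mA; rewrite wsum_atoms sum_cell /=.
rewrite [LHS](FE _ mA) (eq_bigr (fun r => (p j (lift ord0 r) *
  (\1_A (x r : gspace X) + \1_A (- x r : gspace X)))%:E)).
  rewrite diracE -EFinM sumEFin -EFinD indicE; congr (_ + _)%:E.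
  by apply: eq_bigr => r _; rewrite mulrDr.
by move=> r _; rewrite !diracE EFinM EFinD !indicE addeC.
Qed.

Lemma G_represented : represents (chprob G) (cells (pmean p)).
Proof.
move=> A mA; rewrite [LHS](GE mA).
under eq_bigr do rewrite [F _ _](F_represented _ mA).
rewrite sumEFin -EFinM; congr EFin.
under eq_bigr do rewrite wsum_atoms.
rewrite wsum_atoms exchange_big mulr_sumr; apply: eq_bigr => s _ /=.
by rewrite /pmean -mulr_suml; ring.
Qed.

Lemma M_represented j k : represents (M F G j k)
  (cvlist (cells (deviation p j)) (power_atoms (fun s => pmean p (cell_index s))
    (cell_point x) ((n - k) %/ k))).
Proof.
apply: chconv_represented; last exact/chpow_represented/G_represented.
move=> A mA.
rewrite (chsub_represented (@F_represented j) G_represented)// !wsum_atoms.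
by congr EFin; rewrite -sumrB; apply: eq_bigr => s _; rewrite mulrBl.
Qed.

Lemma tvnorm_M j k : exists2 h : gspace X -> R, (forall z, `|h z| <= 1) &
  tvnorm (M F G j k) = \sum_s deviation p j (cell_index s) *
    walk (fun s => pmean p (cell_index s)) (cell_point x) ((n - k) %/ k) h
      (cell_point x s).
Proof.
exists (fun z => hahn_pos (M F G j k) z - hahn_neg (M F G j k) z).
  by move=> z; rewrite norm_hahn_sign.
by rewrite (tvnorm_represented (@M_represented j k)) wsum_conv_power_atoms.
Qed.

Lemma sum_deviation r : \sum_j deviation p j r = 0.
Proof.
rewrite sumrB sumr_const card_ord -mulr_natr /pmean mulfVK ?subrr//.
by rewrite pnatr_eq0 -lt0n.
Qed.

(** The deviations of the F_j from their mean cancel, hence so do the M_(j,k)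
    once summed over j. *)
Lemma nutilde_eq0 k : nutilde F G k = 0.
Proof.
apply: tvnorm_eq0 => A mA; rewrite chsum_apply.
under eq_bigr do rewrite (M_represented _ _ mA) wsum_conv_power_atoms.
rewrite sumEFin exchange_big big1// => s _.
by rewrite -mulr_suml sum_deviation mul0r.
Qed.

Lemma pmean_sum1 : pmean p ord0 + 2 * \sum_(r < b) pmean p (lift ord0 r) = 1.
Proof.
rewrite /pmean -mulr_suml mulrA -mulrDl exchange_big mulr_sumr -big_split/=.
under eq_bigr do rewrite p1.
by rewrite sumr_const card_ord divff// pnatr_eq0 -lt0n.
Qed.

Lemma deviation_mass0 j :
  deviation p j ord0 + 2 * \sum_(r < b) deviation p j (lift ord0 r) = 0.
Proof.
have := p1 j; have := pmean_sum1; rewrite /deviation sumrB; lra.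
Qed.

Lemma tvnorm_M_le j k : `|tvnorm (M F G j k)| <=
  `|deviation p j ord0| + 2 * \sum_(r < b) `|deviation p j (lift ord0 r)|.
Proof.
have [h h1 ->] := tvnorm_M j k.
have q1 : \sum_s pmean p (@cell_index b s) = 1.
  rewrite sum_cell -[RHS]pmean_sum1 mulr_sumr; congr (_ + _).
  by apply: eq_bigr => r _ /=; ring.
apply: (@le_trans _ _ (\sum_s `|deviation p j (@cell_index b s)|)).
  apply: le_trans (ler_norm_sum _ _ _) _; apply: ler_sum => s _.
  rewrite normrM ler_piMr// norm_walk_le1// => t; exact/ltW.
rewrite sum_cell mulr_sumr lerD2l; apply: ler_sum => r _ /=; lra.
Qed.

Lemma tvnorm_M_sqr_le j k (m := ((n - k) %/ k)%N) :
  (m.+2 * m.+1)%:R * tvnorm (M F G j k) ^+ 2 <=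
  (pmean p ord0 - p j ord0) ^+ 2 / (2 * pmean p ord0 ^+ 2)
  + 2 * \sum_(r < b) (pmean p (lift ord0 r) - p j (lift ord0 r)) ^+ 2 /
                     (pmean p (lift ord0 r) * pmean p ord0)
  + \sum_(r < b) (pmean p (lift ord0 r) - p j (lift ord0 r)) ^+ 2 /
                 pmean p (lift ord0 r) ^+ 2.
Proof.
have [h h1 ->] := tvnorm_M j k.
have := second_diff_walk_le x m (deviation_mass0 j) pmean_sum1 pmean_gt0 h1.
have devN r : pmean p r - p j r = - deviation p j r by rewrite /deviation opprB.
move=> /le_trans; apply; rewrite devN sqrrN.
by rewrite lerD ?lerD2l ?ler_pM2l// ler_sum// => r _; rewrite devN sqrrN.
Qed.

(** Since [B] does not depend on [k], termwise bounds survive the maximum. *)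
Lemma eta1_le l (B : 'I_n -> R) :
  (forall j k, (l < k)%N -> tvnorm (M F G j k) ^+ 2 / k%:R ^+ 2 <= B j) ->
  eta1 F G l <= \sum_(j < n) B j.
Proof.
move=> MB; have B0 j : 0 <= B j.
  by apply: le_trans (MB j l.+1 (ltnSn l)); rewrite mulr_ge0 ?invr_ge0 ?sqr_ge0.
rewrite /eta1 big_nat_cond.
apply: bigmax_le => [|k /andP[/andP[lk _] _]]; first exact: sumr_ge0.
rewrite nutilde_eq0 expr0n mul0r add0r mul1r /nu mulr_sumr.
by apply: ler_sum => j _; rewrite mulrC MB.
Qed.

End perturbed_mean.

(** * The bound for eta *)

Theorem proposition2p1 (R : realType) (X : measurableAbGroup) (n b : nat)
  (hn : (0 < n)%N) (hb : (0 < b)%N)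
  (x : 'I_b -> gspace X) (hx : forall r, x r != 0)
  (p : 'I_n -> 'I_b.+1 -> R)
  (hp : forall j r, 0 <= p j r <= 1)
  (hp1 : forall j, p j ord0 + 2 * \sum_(r < b) p j (lift ord0 r) = 1)
  (hpmean : forall r, 0 < pmean p r)
  (F : 'I_n -> probability (gspace X) R)
  (hF : forall j (A : set (gspace X)), measurable A ->
    F j A = ((p j ord0)%:E * \d_(0%R : gspace X) A +
      \sum_(r < b) (p j (lift ord0 r))%:E * (\d_(- x r)%R A + \d_(x r) A))%E)
  (G : probability (gspace X) R)
  (hG : forall A : set (gspace X), measurable A ->
    G A = ((n%:R^-1)%:E * \sum_(j < n) F j A)%E)
  (l : nat) (hl : (1 <= l <= n)%N) :
  eta1 F G l <=
  \sum_(j < n) Num.min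
    (4 / n%:R ^+ 2 *
      ((pmean p ord0 - p j ord0) ^+ 2 / (2 * pmean p ord0 ^+ 2)
       + 2 * \sum_(r < b) (pmean p (lift ord0 r) - p j (lift ord0 r)) ^+ 2 /
                          (pmean p (lift ord0 r) * pmean p ord0)
       + \sum_(r < b) (pmean p (lift ord0 r) - p j (lift ord0 r)) ^+ 2 /
                      pmean p (lift ord0 r) ^+ 2))
    (1 / l.+1%:R ^+ 2 *
      (`|pmean p ord0 - p j ord0|
       + 2 * \sum_(r < b) `|pmean p (lift ord0 r) - p j (lift ord0 r)|) ^+ 2).
Proof.
apply: (eta1_le hn hF hG) => j k lk.
have k0 : (0 < k)%N by exact: leq_trans lk.
rewrite le_min; apply/andP; split.
  apply: sqr_ratio_le => //.
  exact: (tvnorm_M_sqr_le hn hp1 hpmean hF hG).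
rewrite mul1r mulrC ler_pM ?sqr_ge0 ?invr_ge0 ?sqr_ge0//.
  by rewrite lef_pV2 ?posrE ?exprn_gt0 ?ltr0n// lerXn2r ?nnegrE ?ler0n// ler_nat.
rewrite -real_normK ?num_real// lerXn2r ?nnegrE//.
  by rewrite addr_ge0// mulr_ge0// sumr_ge0.
apply: le_trans (tvnorm_M_le hn hp1 hpmean hF hG j k) _.
rewrite distrC; under eq_bigr do rewrite distrC; exact: lexx.
Qed.
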